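(* Let $I$ be the set of conjugacy classes of $\mathrm{PSL}_2(\mathbb{R})$ and, for each $i\in I$, fix a representative $\varphi_i\in\mathrm{PSL}_2(\mathbb{R})$ of the class $i$, with canonical lifting $\widetilde{\varphi}_i\in\widetilde{\mathrm{SL}}_2(\mathbb{R})$. Then for every $\alpha\in\widetilde{\mathrm{SL}}_2(\mathbb{R})$ there is a unique $i\in I$ and a unique $k\in\mathbb{Z}$ for which $\alpha$ is conjugate in $\widetilde{\mathrm{SL}}_2(\mathbb{R})$ to $\mathcal{T}_k\,\widetilde{\varphi}_i$.
   Context: Let $\mathbb{S}^1=\mathbb{R}/\mathbb{Z}$, with $\overline{x}$ the class of $x\in\mathbb{R}$, and let $\mathrm{Homeo}_+(\mathbb{S}^1)$ be the group of orientation-preserving self-homeomorphisms of $\mathbb{S}^1$. Let $$\widetilde{\mathrm{Homeo}}_+(\mathbb{S}^1)=\{\alpha\in \mathrm{Homeo}(\mathbb{R}) : \alpha(x+1)=\alpha(x)+1 \text{ for all } x\in\mathbb{R}\},$$ a group under composition. Each $\alpha$ in it induces $\overline{\alpha}\in\mathrm{Homeo}_+(\mathbb{S}^1)$ by $\overline{\alpha}(\overline{x})=\overline{\alpha(x)}$. For $u\in\mathbb{R}$, $\mathcal{T}_u(x)=x+u$ is the translation by $u$. The kernel of $\alpha\mapsto\overline{\alpha}$ is $\{\mathcal{T}_n\}_{n\in\mathbb{Z}}$. The group $\mathrm{PSL}_2(\mathbb{R})$ acts faithfully and continuously on the real projective line (the set of lines through $0$ in $\mathbb{R}^2$) by its linear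 action, and the projective line is identified with $\mathbb{R}/\mathbb{Z}$ by letting $\overline{x}$ correspond to the line spanned by $(\cos \pi x,\sin\pi x)^{\mathrm{T}}$. This gives an embedding $\mathrm{PSL}_2(\mathbb{R})\hookrightarrow \mathrm{Homeo}_+(\mathbb{S}^1)$, through which elements of $\mathrm{PSL}_2(\mathbb{R})$ are regarded as homeomorphisms of $\mathbb{S}^1$. The group $\widetilde{\mathrm{SL}}_2(\mathbb{R})$ is the preimage of $\mathrm{PSL}_2(\mathbb{R})$ under $\widetilde{\mathrm{Homeo}}_+(\mathbb{S}^1)\to\mathrm{Homeo}_+(\mathbb{S}^1)$, $\alpha\mapsto\overline{\alpha}$. Canonical lifting: for $\varphi\in\mathrm{Homeo}_+(\mathbb{S}^1)$, $\widetilde{\varphi}$ is the unique element of $\widetilde{\mathrm{Homeo}}_+(\mathbb{S}^1)$ with $\overline{\widetilde{\varphi}}=\varphi$ and $\widetilde{\varphi}(0)\in[0,1)$; if $\varphi\in\mathrm{PSL}_2(\mathbb{R})$, then $\widetilde{\varphi}\in\widetilde{\mathrm{SL}}_2(\mathbb{R})$. *)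

(* Defs.v *)
From HB Require Import structures.
From mathcomp Require Import all_boot all_order all_algebra generic_quotient.
From mathcomp Require Import all_classical all_reals all_analysis.

Set Implicit Arguments.
Unset Strict Implicit.
Unset Printing Implicit Defensive.

Import Order.TTheory GRing.Theory Num.Theory.
Import numFieldNormedType.Exports.

Local Open Scope classical_set_scope.
Local Open Scope quotient_scope.
Local Open Scope ring_scope.

Section Conjugacy.
Variable G : groupType.

Definition conjugate_in (H : set G) (x y : G) : Prop :=
  exists2 h, H h & y = conjg x h.

Definition is_conj_class (C : set G) : Prop :=
  exists x, C = [set y | conjugate_in setT x y].

Definition conj_class : Type := {C : set G | is_conj_class C}.

End Conjugacy.

Definition homeomorphism (S T : topologicalType) (f : S -> T) : Prop :=
  continuous f /\
  exists2 g : T -> S, continuous g & cancel f g /\ cancel g f.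

Section HomeoTilde.
Variable R : realType.

Record homeo_tilde := HomeoTilde {
  ht_fun :> R -> R;
  ht_homeo : homeomorphism ht_fun;
  ht_addr1 : forall x, ht_fun (x + 1) = ht_fun x + 1 }.

Lemma ht_ext (a b : homeo_tilde) : a =1 b -> a = b.
Proof.
case: a b => [f fh f1] [g gh g1] /= /funext fg; subst g.
by rewrite (Prop_irrelevance fh gh) (Prop_irrelevance f1 g1).
Qed.

Lemma translation_homeo (u : R) : homeomorphism (fun x : R => x + u).
Proof.
split; first by move=> x; apply: cvgD; [exact: cvg_id|exact: cvg_cst].
exists (fun x => x - u); last by split=> x; rewrite ?addrK ?subrK.
by move=> x; apply: cvgB; [exact: cvg_id|exact: cvg_cst].
Qed.

Definition translation (u : R) : homeo_tilde :=
  HomeoTilde (translation_homeo u) (fun x => addrAC x 1 u).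

Definition ht_one : homeo_tilde := translation 0.

Lemma ht_mul_homeo (a b : homeo_tilde) : homeomorphism (a \o b).
Proof.
case: (ht_homeo a) => ac [a' a'c [aK a'K]].
case: (ht_homeo b) => bc [b' b'c [bK b'K]].
split; first by move=> x; apply: continuous_comp; [exact: bc|exact: ac].
exists (b' \o a').
  by move=> x; apply: continuous_comp; [exact: a'c|exact: b'c].
by split=> x /=; rewrite ?aK ?bK ?b'K ?a'K.
Qed.

Lemma ht_mul_addr1 (a b : homeo_tilde) x : (a \o b) (x + 1) = (a \o b) x + 1.
Proof. by rewrite /= !ht_addr1. Qed.

Definition ht_mul (a b : homeo_tilde) : homeo_tilde :=
  HomeoTilde (ht_mul_homeo a b) (ht_mul_addr1 a b).

Definition ht_inv_fun (a : homeo_tilde) : R -> R :=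
  s2val (cid2 (ht_homeo a).2).

Lemma ht_invK (a : homeo_tilde) :
  cancel a (ht_inv_fun a) /\ cancel (ht_inv_fun a) a.
Proof. exact: (s2valP' (cid2 (ht_homeo a).2)). Qed.

Lemma ht_inv_homeo (a : homeo_tilde) : homeomorphism (ht_inv_fun a).
Proof.
split; first exact: (s2valP (cid2 (ht_homeo a).2)).
by exists a; [exact: (ht_homeo a).1|case: (ht_invK a)].
Qed.

Lemma ht_inv_addr1 (a : homeo_tilde) x :
  ht_inv_fun a (x + 1) = ht_inv_fun a x + 1.
Proof.
have [aK a'K] := ht_invK a.
by apply: (can_inj aK); rewrite ht_addr1 !a'K.
Qed.

Definition ht_inv (a : homeo_tilde) : homeo_tilde :=
  HomeoTilde (ht_inv_homeo a) (ht_inv_addr1 a).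

HB.instance Definition _ := gen_eqMixin homeo_tilde.
HB.instance Definition _ := gen_choiceMixin homeo_tilde.

Lemma ht_mulA : associative ht_mul.
Proof. by move=> a b c; apply: ht_ext. Qed.
Lemma ht_mul1 : left_id ht_one ht_mul.
Proof. by move=> a; apply: ht_ext => x /=; rewrite addr0. Qed.
Lemma ht_mulr1 : right_id ht_one ht_mul.
Proof. by move=> a; apply: ht_ext => x /=; rewrite addr0. Qed.
Lemma ht_mulV : left_inverse ht_one ht_inv ht_mul.
Proof.
by move=> a; apply: ht_ext => x /=; rewrite addr0; case: (ht_invK a) => ->.
Qed.
Lemma ht_mulrV : right_inverse ht_one ht_inv ht_mul.
Proof.
by move=> a; apply: ht_ext => x /=; rewrite addr0; case: (ht_invK a) => _ ->.
Qed.

HB.instance Definition _ := isGroup.Build homeo_tilde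
  ht_mulA ht_mul1 ht_mulr1 ht_mulV ht_mulrV.

End HomeoTilde.

Section Circle.
Variable R : realType.

Definition circle_rel (x y : R) : bool := x - y \is a Num.int.

Lemma circle_rel_equiv : equiv_class_of circle_rel.
Proof.
split=> [x|x y|y x z]; rewrite /circle_rel ?subrr ?rpred0 //.
  by rewrite -opprB rpredN.
by move=> xy yz; rewrite -(subrKA y) rpredD.
Qed.

Canonical circle_rel_canonical := EquivRelPack circle_rel_equiv.

Definition circle : Type := {eq_quot circle_rel}.
HB.instance Definition _ := EqQuotient.on circle.

Definition cls (x : R) : circle := \pi_circle x.

Lemma cls_eqP (x y : R) : reflect (cls x = cls y) (x - y \is a Num.int).
Proof. by apply: (iffP idP) => [h|/eqmodP //]; apply/eqmodP. Qed.

Lemma ht_addz (a : homeo_tilde R) (x : R) (k : int) :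
  a (x + k%:~R) = a x + k%:~R.
Proof.
have natD (n : nat) y : a (y + n%:R) = a y + n%:R.
  elim: n y => [|n IH] y; first by rewrite !addr0.
  by rewrite -addn1 natrD addrA ht_addr1 IH addrA.
case: k => n; first exact: natD.
rewrite NegzE mulrNz; apply/eqP; rewrite -subr_eq opprK.
by rewrite -[in X in _ == X](subrK n.+1%:R x) natD.
Qed.

Definition bar (a : homeo_tilde R) (x : circle) : circle := cls (a (repr x)).

Lemma barE (a : homeo_tilde R) (x : R) : bar a (cls x) = cls (a x).
Proof.
have /cls_eqP/intrP[k xk] : cls (repr (cls x)) = cls x by exact: reprK.
rewrite /bar; have -> : repr (cls x) = x + k%:~R by rewrite -xk addrC subrK.
by apply/cls_eqP; rewrite ht_addz addrAC subrr add0r intr_int.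
Qed.

(* The default value 1 of xget is irrelevant: the set is a singleton whenever
   f is an orientation-preserving homeomorphism. *)
Definition canonical_lift (f : circle -> circle) : homeo_tilde R :=
  xget 1%g [set a | bar a = f /\ 0 <= a 0 < 1].

End Circle.

Section PSL2.
Variable R : realType.

Record SL2 := MkSL2 { SL2_val :> 'M[R]_2; SL2_det : \det SL2_val == 1 }.
HB.instance Definition _ := [isSub for SL2_val].
HB.instance Definition _ := [Choice of SL2 by <:].

Lemma SL2_unit (A : SL2) : (A : 'M[R]_2) \in unitmx.
Proof. by rewrite unitmxE (eqP (SL2_det A)) unitr1. Qed.

Fact SL2_one_det : \det (1%:M : 'M[R]_2) == 1. Proof. by rewrite det1. Qed.
Fact SL2_mul_det (A B : SL2) : \det (A *m B) == 1.
Proof. by rewrite det_mulmx (eqP (SL2_det A)) (eqP (SL2_det B)) mulr1. Qed.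
Fact SL2_inv_det (A : SL2) : \det (invmx A) == 1.
Proof. by rewrite det_inv (eqP (SL2_det A)) invr1. Qed.
Fact SL2_opp_det (A : SL2) : \det (- (A : 'M[R]_2)) == 1.
Proof. by rewrite -scaleN1r detZ (eqP (SL2_det A)) sqrrN expr1n mulr1. Qed.

Definition SL2_one := MkSL2 SL2_one_det.
Definition SL2_mul (A B : SL2) := MkSL2 (SL2_mul_det A B).
Definition SL2_inv (A : SL2) := MkSL2 (SL2_inv_det A).

Fact SL2_mulA : associative SL2_mul.
Proof. by move=> A B C; apply: val_inj; rewrite /= mulmxA. Qed.
Fact SL2_mul1 : left_id SL2_one SL2_mul.
Proof. by move=> A; apply: val_inj; rewrite /= mul1mx. Qed.
Fact SL2_mulr1 : right_id SL2_one SL2_mul.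
Proof. by move=> A; apply: val_inj; rewrite /= mulmx1. Qed.
Fact SL2_mulV : left_inverse SL2_one SL2_inv SL2_mul.
Proof. by move=> A; apply: val_inj; rewrite /= mulVmx ?SL2_unit. Qed.
Fact SL2_mulrV : right_inverse SL2_one SL2_inv SL2_mul.
Proof. by move=> A; apply: val_inj; rewrite /= mulmxV ?SL2_unit. Qed.

HB.instance Definition _ := isGroup.Build SL2
  SL2_mulA SL2_mul1 SL2_mulr1 SL2_mulV SL2_mulrV.

Definition PSL2_rel (A B : SL2) : bool :=
  ((A : 'M[R]_2) == B) || ((A : 'M[R]_2) == - (B : 'M[R]_2)).

Lemma PSL2_relP (A B : SL2) :
  reflect (exists b : bool, (A : 'M[R]_2) = (-1) ^+ b *: (B : 'M[R]_2))
          (PSL2_rel A B).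
Proof.
apply: (iffP orP) => [[/eqP AB|/eqP AB]|[[] AB]].
- by exists false; rewrite scale1r.
- by exists true; rewrite scaleN1r.
- by right; rewrite AB expr1 scaleN1r.
- by left; rewrite AB expr0 scale1r.
Qed.

Lemma PSL2_rel_equiv : equiv_class_of PSL2_rel.
Proof.
split=> [A|A B|B A C]; rewrite /PSL2_rel.
- by rewrite eqxx.
- by rewrite eq_sym -[X in _ || X]eqr_opp opprK [in X in _ || X]eq_sym.
- case/orP=> /eqP ->; case/orP=> /eqP ->;
  by rewrite ?opprK eqxx ?orbT.
Qed.

Canonical PSL2_rel_canonical := EquivRelPack PSL2_rel_equiv.

Definition PSL2 : Type := {eq_quot PSL2_rel}.
HB.instance Definition _ := Choice.on PSL2.
HB.instance Definition _ := EqQuotient.on PSL2.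

Definition PSL2_cls (A : SL2) : PSL2 := \pi_PSL2 A.

Lemma PSL2_cls_eqP (A B : SL2) :
  reflect (PSL2_cls A = PSL2_cls B) (PSL2_rel A B).
Proof. by apply: (iffP idP) => [h|/eqmodP //]; apply/eqmodP. Qed.

Lemma PSL2_clsK (g : PSL2) : PSL2_cls (repr g) = g.
Proof. exact: reprK. Qed.

Lemma PSL2_repr_cls (A : SL2) :
  exists b : bool, (repr (PSL2_cls A) : 'M[R]_2) = (-1) ^+ b *: (A : 'M[R]_2).
Proof. by apply/PSL2_relP/PSL2_cls_eqP; rewrite PSL2_clsK. Qed.

Definition PSL2_one : PSL2 := PSL2_cls 1%g.
Definition PSL2_mul (g h : PSL2) : PSL2 := PSL2_cls (repr g * repr h)%g.
Definition PSL2_inv (g : PSL2) : PSL2 := PSL2_cls (repr g)^-1%g.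

Lemma PSL2_mulE (A B : SL2) :
  PSL2_mul (PSL2_cls A) (PSL2_cls B) = PSL2_cls (A * B)%g.
Proof.
have [b Ab] := PSL2_repr_cls A; have [c Bc] := PSL2_repr_cls B.
apply/PSL2_cls_eqP/PSL2_relP; exists (b (+) c).
by rewrite /= Ab Bc -scalemxAl -scalemxAr scalerA signr_addb.
Qed.

Lemma PSL2_invE (A : SL2) : PSL2_inv (PSL2_cls A) = PSL2_cls A^-1%g.
Proof.
have [b Ab] := PSL2_repr_cls A.
apply/PSL2_cls_eqP/PSL2_relP; exists b.
by rewrite /= Ab invmxZ ?unitmxZ ?SL2_unit ?unitrX ?unitrN1 // invr_sign.
Qed.

Fact PSL2_mulA : associative PSL2_mul.
Proof.
move=> g h k; rewrite -(PSL2_clsK g) -(PSL2_clsK h) -(PSL2_clsK k).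
by rewrite !PSL2_mulE mulgA.
Qed.
Fact PSL2_mul1 : left_id PSL2_one PSL2_mul.
Proof. by move=> g; rewrite -(PSL2_clsK g) PSL2_mulE mul1g. Qed.
Fact PSL2_mulr1 : right_id PSL2_one PSL2_mul.
Proof. by move=> g; rewrite -(PSL2_clsK g) PSL2_mulE mulg1. Qed.
Fact PSL2_mulV : left_inverse PSL2_one PSL2_inv PSL2_mul.
Proof. by move=> g; rewrite -(PSL2_clsK g) PSL2_invE PSL2_mulE mulVg. Qed.
Fact PSL2_mulrV : right_inverse PSL2_one PSL2_inv PSL2_mul.
Proof. by move=> g; rewrite -(PSL2_clsK g) PSL2_invE PSL2_mulE mulgV. Qed.

HB.instance Definition _ := isGroup.Build PSL2
  PSL2_mulA PSL2_mul1 PSL2_mulr1 PSL2_mulV PSL2_mulrV.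

End PSL2.

Section ProjectiveLine.
Variable R : realType.

Definition proj_line : Type := {V : {vspace 'cV[R]_2} | \dim V == 1%N}.

Lemma proj_lineP (L : proj_line) : exists2 v, v != 0 & val L = <[v]>%VS.
Proof.
case: L => V /= dV; exists (vpick V); first by rewrite vpick0 -dimv_eq0 (eqP dV).
apply/esym/eqP; rewrite eqEdim -memvE memv_pick (eqP dV) dim_vline vpick0.
by rewrite -dimv_eq0 (eqP dV).
Qed.

Definition mx_act (A : 'M[R]_2) (V : {vspace 'cV[R]_2}) : {vspace 'cV[R]_2} :=
  (linfun (mulmx A) @: V)%VS.

Lemma mx_act_line A v : mx_act A <[v]>%VS = <[A *m v]>%VS.
Proof. by rewrite /mx_act limg_line lfunE. Qed.

Fact SL2_act_dim (A : SL2 R) (L : proj_line) : \dim (mx_act A (val L)) == 1%N.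
Proof.
have [v v0 ->] := proj_lineP L; rewrite mx_act_line dim_vline.
suff -> : (A : 'M[R]_2) *m v != 0 by [].
by apply: contraNneq v0 => Av; rewrite -[v](mulKmx (SL2_unit A)) Av mulmx0.
Qed.

Definition SL2_act (A : SL2 R) (L : proj_line) : proj_line :=
  exist _ (mx_act A (val L)) (SL2_act_dim A L).

Definition PSL2_act (g : PSL2 R) (L : proj_line) : proj_line :=
  SL2_act (repr g) L.

Lemma PSL2_actE (A : SL2 R) (L : proj_line) :
  PSL2_act (PSL2_cls A) L = SL2_act A L.
Proof.
have [b Ab] := PSL2_repr_cls A; apply: val_inj => /=.
have [v v0 ->] := proj_lineP L; rewrite !mx_act_line Ab -scalemxAl.
apply/vspaceP => w; apply/vlineP/vlineP => -[k ->].
  by exists (k * (-1) ^+ b); rewrite scalerA.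
by exists (k * (-1) ^+ b); rewrite scalerA -mulrA -signr_addb addbb mulr1.
Qed.

Definition circle_vec (x : R) : 'cV[R]_2 :=
  \col_i (if i == 0 then cos (pi * x) else sin (pi * x)).

Lemma circle_vec_neq0 x : circle_vec x != 0.
Proof.
apply/eqP => /matrixP h; have := cos2Dsin2 (pi * x).
have := h 0 0; have := h 1 0; rewrite !mxE /= => -> ->.
by rewrite expr0n addr0 => /eqP; rewrite eq_sym oner_eq0.
Qed.

Fact circle_line_dim x : \dim <[circle_vec x]> == 1%N.
Proof. by rewrite dim_vline circle_vec_neq0. Qed.

Definition line_of_circle (x : circle R) : proj_line :=
  exist _ <[circle_vec (repr x)]>%VS (circle_line_dim (repr x)).

Lemma circle_vecD1 x : circle_vec (x + 1) = - circle_vec x.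
Proof.
by apply/matrixP => i j; rewrite !mxE mulrDr mulr1 cosDpi sinDpi; case: ifP.
Qed.

Lemma circle_vecDz x (k : int) :
  exists b : bool, circle_vec (x + k%:~R) = (-1) ^+ b *: circle_vec x.
Proof.
have natD (n : nat) y : circle_vec (y + n%:R) = (-1) ^+ (odd n) *: circle_vec y.
  elim: n y => [|n IH] y; first by rewrite addr0 scale1r.
  by rewrite -natr1 addrA circle_vecD1 IH /= signrN scaleNr.
case: k => n; first by exists (odd n); exact: natD.
exists (odd n.+1); rewrite NegzE mulrNz.
rewrite -[in RHS](subrK n.+1%:R x) natD scalerA -signr_addb addbb scale1r.
by [].
Qed.

Lemma line_of_circleE x :
  val (line_of_circle (cls x)) = <[circle_vec x]>%VS.
Proof.
have /cls_eqP/intrP[k xk] : cls (repr (cls x)) = cls x by exact: reprK.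
have -> /= : val (line_of_circle (cls x)) = <[circle_vec (x + k%:~R)]>%VS.
  by rewrite -xk addrC subrK.
have [b ->] := circle_vecDz x k.
apply/vspaceP => w; apply/vlineP/vlineP => -[c ->].
  by exists (c * (-1) ^+ b); rewrite scalerA.
by exists (c * (-1) ^+ b); rewrite scalerA -mulrA -signr_addb addbb mulr1.
Qed.

Lemma sin_pi_eq0 (t : R) : sin (pi * t) = 0 -> t \is a Num.int.
Proof.
move=> st; pose n := Num.floor t; pose s := t - n%:~R.
have s01 : 0 <= s < 1.
  by rewrite subr_ge0 ltrBlDl floor_le /= -[1]/(1%:~R) -intrD floorD1_gt.
have ss : sin (pi * s) = 0.
  have [b /matrixP/(_ 1 0)] := circle_vecDz t (- n).
  by rewrite !mxE /= st mulr0 mulrNz.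
have [s0|s0] := eqVneq s 0.
  by rewrite (_ : t = n%:~R) ?intr_int //; apply/eqP; rewrite -subr_eq0; apply/eqP.
suff : 0 < sin (pi * s) by rewrite ss ltxx.
apply: sin_gt0_pi; case/andP: s01 => s_ge0 s_lt1.
by rewrite mulr_gt0 ?pi_gt0 ?lt0r ?s0 //= gtr_pMr // pi_gt0.
Qed.

Lemma line_of_circle_inj : injective line_of_circle.
Proof.
move=> x y; rewrite -(reprK x) -(reprK y) -/(cls _) -/(cls (repr y)).
set u := repr x; set v := repr y => uv.
apply/cls_eqP/sin_pi_eq0.
have : circle_vec u \in <[circle_vec v]>%VS.
  by rewrite -line_of_circleE -uv line_of_circleE memv_line.
case/vlineP => k /matrixP h; have := h 0 0; have := h 1 0.
rewrite !mxE /= => su cu.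
by rewrite mulrBr sinB su cu -!mulrA (mulrC (sin _)) subrr.
Qed.

Lemma line_of_circle_surj (L : proj_line) : exists x, line_of_circle x = L.
Proof.
have [w w0 Lw] := proj_lineP L.
have [v [v0 Lv v1]] : exists v, [/\ v != 0, val L = <[v]>%VS & 0 <= v 1 0].
  have [?|wn] := leP 0 (w 1 0); first by exists w.
  exists (- w); split; rewrite ?oppr_eq0 ?mxE ?oppr_ge0 ?ltW //.
  rewrite Lw; apply/vspaceP => z; apply/vlineP/vlineP => -[c ->].
    by exists (- c); rewrite scalerN scaleNr opprK.
  by exists (- c); rewrite scalerN scaleNr.
pose q := v 0 0 ^+ 2 + v 1 0 ^+ 2.
have q0 : 0 < q.
  rewrite lt0r addr_ge0 ?sqr_ge0 // andbT; apply: contraNneq v0.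
  move=> /eqP; rewrite paddr_eq0 ?sqr_ge0 // !sqrf_eq0 => /andP[/eqP a /eqP b].
  apply/eqP/matrixP => i j; rewrite !mxE (ord1 j).
  by case: i => -[|[|//]] i; [rewrite -[RHS]a|rewrite -[RHS]b];
    congr (v _ _); apply: val_inj.
pose r := Num.sqrt q; have r0 : 0 < r by rewrite sqrtr_gt0.
have rq : r ^+ 2 = q by rewrite sqr_sqrtr // ltW.
pose c := v 0 0 / r.
have sE : 1 - c ^+ 2 = (v 1 0 / r) ^+ 2.
  rewrite !expr_div_n rq -(divff (lt0r_neq0 q0)) -mulrBl; congr (_ / _).
  by rewrite /q addrAC subrr add0r.
have c1 : -1 <= c <= 1.
  by rewrite -ler_norml -(@expr_le1 _ 2) // real_normK ?num_real //
    -subr_ge0 sE sqr_ge0.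
exists (cls (acos c / pi)); apply: val_inj; rewrite line_of_circleE Lv.
have -> : circle_vec (acos c / pi) = r^-1 *: v.
  have pi_neq0 : pi != 0 :> R by rewrite gt_eqF ?pi_gt0.
  apply/matrixP => i j; rewrite !mxE (ord1 j) [pi * _]mulrC divfK //.
  rewrite acosK ?in_itv //= sin_acos // sE sqrtr_sqr ger0_norm; last first.
    by rewrite divr_ge0 // ltW.
  by case: i => -[|[|//]] i /=; rewrite /c mulrC; congr (_ * v _ _); apply: val_inj.
apply/vspaceP => z; apply/vlineP/vlineP => -[k ->].
  by exists (k / r); rewrite scalerA.
by exists (k * r); rewrite scalerA mulfK // gt_eqF.
Qed.

Definition circle_of_line (L : proj_line) : circle R :=
  xget (cls 0) [set x | line_of_circle x = L].

Lemma circle_of_lineK : cancel circle_of_line line_of_circle.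
Proof.
move=> L; have [x xL] := line_of_circle_surj L.
exact: (@xgetPex _ _ [set x | line_of_circle x = L] (ex_intro _ x xL)).
Qed.

Lemma line_of_circleK : cancel line_of_circle circle_of_line.
Proof. by move=> x; apply: line_of_circle_inj; rewrite circle_of_lineK. Qed.

Definition PSL2_homeo (g : PSL2 R) (x : circle R) : circle R :=
  circle_of_line (PSL2_act g (line_of_circle x)).

Definition SL2_tilde : set (homeo_tilde R) :=
  @bar R @^-1` range PSL2_homeo.

End ProjectiveLine.

(* Main.v *)
(* Existence: if alpha lifts g and h conjugates g to the representative phi_i, a
   lift of h conjugates alpha to some lift of phi_i, and two lifts differ by an
   integer translation, which is central.  Lifts exist because every matrix in
   SL_2(R) is a rotation times a symmetric matrix; rotations lift to translations,
   and a symmetric matrix of determinant 1 turns each line by an angle in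
   ]-pi/2, pi/2[, which depends continuously on the line.
   Uniqueness: the class i is read off in PSL_2(R), which acts faithfully on the
   circle.  If T_m c is conjugate to c, then so are T_(mn) c^n and c^n for all n;
   conjugation changes displacements by a bounded amount, so m = 0. *)
Require Import Defs.
From HB Require Import structures.
From mathcomp Require Import all_boot all_order all_algebra.
From mathcomp Require Import all_classical all_reals all_analysis.
From mathcomp Require Import ring lra zify.

Import Order.TTheory GRing.Theory Num.Theory.
Import numFieldNormedType.Exports.

Local Open Scope ring_scope.

Lemma frac_decomp (R : realType) (x : R) :
  exists (y : R) (k : int), 0 <= y < 1 /\ x = y + k%:~R.
Proof.
exists (x - (Num.floor x)%:~R), (Num.floor x); rewrite subrK subr_ge0 floor_le.
by rewrite ltrBlDr addrC -[1]/(1%:~R) -intrD floorD1_gt.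
Qed.

(** * Lifts to the real line: monotonicity, kernel of [bar], displacements *)

Section HomeoTildeTheory.
Variable R : realType.
Implicit Types (a b c h : homeo_tilde R) (x y : R) (k m : int).

(** A continuous injection of the line is monotone, and [a 0 <= a 0 + 1 = a 1] decides the
    direction. *)
Lemma ht_le a : {mono a : x y / x <= y}.
Proof.
move=> x y; have [aK _] := ht_invK a.
apply: (@itv_continuous_inj_le R a `]-oo, +oo[) => //.
- by exists 0, 1; split => //; rewrite -[1]add0r ht_addr1 lerDl.
- by apply/continuous_subspaceT; exact: (ht_homeo a).1.
- by move=> u v _ _; exact: (can_inj aK).
Qed.

Lemma ht_lt a : {mono a : x y / x < y}.
Proof. exact: leW_mono (ht_le a). Qed.

Lemma bar_mul a b : bar (a * b)%g = bar a \o bar b.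
Proof. by apply/funext => x; rewrite -(reprK x) -/(cls _) /= !barE. Qed.

Lemma bar_translation k : bar (translation k%:~R) = id :> (circle R -> _).
Proof.
apply/funext => x; rewrite -(reprK x) -/(cls _) barE.
by apply/cls_eqP; rewrite /= addrAC subrr add0r intr_int.
Qed.

Lemma bar_inv a : bar a^-1%g \o bar a = id.
Proof. by rewrite -bar_mul mulVg -[RHS](bar_translation 0). Qed.

Lemma bar_one : bar (1%g : homeo_tilde R) = id.
Proof. by rewrite -[RHS](bar_translation 0). Qed.

Lemma translation_conj k a : (translation k%:~R ^ a)%g = translation k%:~R.
Proof.
rewrite conjgE [(translation _ * a)%g](_ : _ = (a * translation k%:~R)%g) ?mulKg //.
by apply: ht_ext => x /=; rewrite ht_addz.
Qed.

Lemma translationD k m :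
  translation (k + m)%:~R = (translation k%:~R * translation m%:~R)%g
  :> homeo_tilde R.
Proof. by apply: ht_ext => x /=; rewrite intrD addrA addrAC. Qed.

Lemma bar_id a : bar a = id -> exists k, a = translation k%:~R.
Proof.
move=> a1.
have a_int x : exists k, a x = x + k%:~R.
  have /cls_eqP/intrP[k xk] : cls (a x) = cls x by rewrite -barE a1.
  by exists k; rewrite -xk addrC subrK.
have [k a0] := a_int 0; exists k; apply: ht_ext => x /=.
have [y [n [/andP[y0 y1] ->]]] := frac_decomp R x; rewrite ht_addz.
have [m ym] := a_int y.
have le0y : a 0 <= a y by rewrite ht_le.
have lty1 : a y < a (0 + 1) by rewrite ht_lt add0r.
(* Here [k <= y + m < k + 1] and [0 <= y < 1], which leaves only one integer. *)
suff -> : k = m by rewrite ym addrAC.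
move: le0y lty1; rewrite ht_addr1 a0 ym => ? ?.
have h1 : (k - m)%:~R < 1 :> R by rewrite intrD intrN; lra.
have h2 : (-1)%:~R < (k - m)%:~R :> R by rewrite intrD !intrN; lra.
move: h1 h2; rewrite -[1 in X in X -> _]/(1%:~R) !ltr_int; lia.
Qed.

Lemma bar_inj a b : bar a = bar b -> exists k, a = (translation k%:~R * b)%g.
Proof.
move=> ab; have [k abk] : exists k, (a * b^-1)%g = translation k%:~R.
  by apply: bar_id; rewrite bar_mul ab -bar_mul mulgV bar_one.
by exists k; rewrite -abk divgK.
Qed.

(** The displacement [h x - x] has period 1, and for [0 <= y < 1] monotonicity gives
    [h 0 <= h y < h 0 + 1]. *)
Lemma ht_displacement h (K : nat) x :
  `|h 0| <= K%:R -> `|h x - x| <= K%:R + 1.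
Proof.
have [y [n [/andP[y0 y1] ->]]] := frac_decomp R x; rewrite ht_addz => h0.
have : h 0 <= h y by rewrite ht_le.
have : h y < h (0 + 1) by rewrite ht_lt add0r.
rewrite ht_addr1; move: h0; rewrite !ler_norml => /andP[? ?] ? ?.
by apply/andP; split; lra.
Qed.

Lemma conjg_translation_eq0 c h k : (c ^ h)%g = (translation k%:~R * c)%g -> k = 0.
Proof.
move=> ch.
have chE x : c (h x) = h (c x) + k%:~R.
  have /(congr1 (fun a : homeo_tilde R => a x)) : (c * h = h * (c ^ h))%g.
    by rewrite conjgE mulVKg.
  by rewrite ch /= ht_addz.
have iterE n : iter n c (h 0) = h (iter n c 0) + k%:~R * n%:R.
  elim: n => [|n IH] /=; first by rewrite mulr0 addr0.
  rewrite IH -[k%:~R * _]/(_ * n%:~R) -intrM ht_addz chE -addrA.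
  by rewrite intrM -natr1 mulrDr mulr1 [k%:~R + _]addrC.
pose K := Num.bound `|h 0|.
have hK : `|h 0| <= K%:R by exact/ltW/archi_boundP/normr_ge0.
have iter_le n x y : (iter n c x <= iter n c y) = (x <= y).
  by elim: n => //= n <-; rewrite ht_le.
have iterDz n x m : iter n c (x + m%:~R) = iter n c x + m%:~R.
  by elim: n => //= n ->; rewrite ht_addz.
(* By monotonicity [iter n c (h 0)] is within [K] of [iter n c 0], and [h] moves the latter by at
   most [K + 1]. So [k n] has absolute value at most [2K + 1], which is less than this [n]. *)
pose n := (K + K).+2.
have := ht_displacement h K (iter n c 0) hK.
have := iterE n.
have : iter n c (h 0) <= iter n c 0 + (K : int)%:~R.
  by rewrite -iterDz iter_le add0r; move: hK; rewrite ler_norml => /andP[].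
have : iter n c 0 + (- (K : int))%:~R <= iter n c (h 0).
  by rewrite -iterDz iter_le add0r intrN; move: hK; rewrite ler_norml => /andP[].
rewrite intrN; set u := iter n c 0; set v := iter n c (h 0) => uv vu vE.
rewrite ler_norml => /andP[? ?].
have nE : n%:R = 2 * K%:R + 2 :> R by rewrite /n -addn2 !natrD; ring.
have n0 : 0 < n%:R :> R by rewrite ltr0n.
move: uv vu; rewrite vE -[(K : int)%:~R]/(K%:R) => ? ?.
have : k%:~R * n%:R < 1%:~R * n%:R :> R by rewrite mul1r; lra.
have : (-1)%:~R * n%:R < k%:~R * n%:R :> R by rewrite mulN1r; lra.
by rewrite !ltr_pM2r // !ltr_int; lia.
Qed.

End HomeoTildeTheory.

(** * The action of [PSL2] on the circle and its faithfulness *)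

Section ProjectiveAction.
Variable R : realType.
Implicit Types (A B : SL2 R) (g h : PSL2 R) (x y t : R).

Lemma det_mx2 (M : 'M[R]_2) : \det M = M 0 0 * M 1 1 - M 0 1 * M 1 0.
Proof.
rewrite (expand_det_row _ 0) big_ord_recl big_ord1 /cofactor !det_mx11 !mxE.
rewrite expr0 mul1r /= expr1 mulN1r mulrN.
by congr (M _ _ * M _ _ - M _ _ * M _ _); exact: val_inj.
Qed.

Lemma mulmx2 p n (M : 'M[R]_(p, 2)) (N : 'M[R]_(2, n)) i j :
  (M *m N) i j = M i 0 * N 0 j + M i 1 * N 1 j.
Proof.
rewrite mxE big_ord_recl big_ord1; congr (M _ _ * N _ _ + M _ _ * N _ _);
by exact: val_inj.
Qed.

Lemma ord2_ind (P : 'I_2 -> Prop) : P 0 -> P 1 -> forall i, P i.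
Proof.
move=> P0 P1 [[|[|//]] i]; first by rewrite (_ : Ordinal i = 0) //; apply: val_inj.
by rewrite (_ : Ordinal i = 1) //; apply: val_inj.
Qed.

(** The cross product of the two vectors is, up to sign, [sin (pi * (x - y))], and it vanishes for
    collinear vectors. *)
Lemma circle_vec_collinear x y (k : R) :
  circle_vec x = k *: circle_vec y -> cls x = cls y.
Proof.
move=> /matrixP h; apply/cls_eqP/sin_pi_eq0.
have := h 0 0; have := h 1 0; rewrite !mxE /= => sx cx.
by rewrite mulrBr sinB sx cx; ring.
Qed.

Lemma circle_vec_line (v : 'cV[R]_2) : v != 0 ->
  exists x (k : R), k != 0 /\ v = k *: circle_vec x.
Proof.
move=> v0; have dv : \dim <[v]> == 1%N by rewrite dim_vline v0.
have [z zv] := line_of_circle_surj (exist _ <[v]>%VS dv).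
have : v \in val (line_of_circle z) by rewrite zv memv_line.
rewrite -(reprK z) -/(cls _) line_of_circleE => /vlineP[k vk].
exists (repr z), k; split => //.
by apply: contra_neq v0 => k0; rewrite vk k0 scale0r.
Qed.

Lemma PSL2_actM g h L : PSL2_act (g * h)%g L = PSL2_act g (PSL2_act h L).
Proof.
rewrite -(PSL2_clsK g) -(PSL2_clsK h) [(_ * _)%g]PSL2_mulE !PSL2_actE.
apply: val_inj => /=; have [v v0 ->] := proj_lineP L.
by rewrite !mx_act_line mulmxA.
Qed.

Lemma PSL2_homeoM g h : PSL2_homeo (g * h)%g = PSL2_homeo g \o PSL2_homeo h.
Proof.
by apply/funext => x; rewrite /PSL2_homeo /= PSL2_actM circle_of_lineK.
Qed.

Lemma PSL2_homeo1 : PSL2_homeo (1%g : PSL2 R) = id.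
Proof.
apply/funext => x; rewrite /PSL2_homeo PSL2_actE -[RHS]line_of_circleK.
congr circle_of_line; apply: val_inj => /=.
by rewrite mx_act_line mul1mx.
Qed.

(** Reduces the action on the circle to a matrix computation; [k] is nonzero because [A] is
    invertible. *)
Lemma PSL2_homeo_cls A x y (k : R) : A *m circle_vec x = k *: circle_vec y ->
  PSL2_homeo (PSL2_cls A) (cls x) = cls y.
Proof.
move=> Axy; apply: line_of_circle_inj.
rewrite circle_of_lineK PSL2_actE; apply: val_inj.
have -> : val (SL2_act A (line_of_circle (cls x))) = mx_act A <[circle_vec x]>%VS.
  by rewrite -line_of_circleE.
rewrite line_of_circleE mx_act_line Axy.
have k0 : k != 0.
  apply: contra_neq (circle_vec_neq0 x) => k0.
  by rewrite -[LHS](mulKmx (SL2_unit A)) Axy k0 scale0r mulmx0.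
apply/vspaceP => w; apply/vlineP/vlineP => -[c ->].
  by exists (c * k); rewrite scalerA.
by exists (c / k); rewrite scalerA divfK.
Qed.

(** A matrix fixing every line has every nonzero vector as an eigenvector, so it is scalar, and
    determinant 1 leaves only the scalars 1 and -1. *)
Lemma PSL2_homeo_id g : PSL2_homeo g = id -> g = 1%g.
Proof.
rewrite -(PSL2_clsK g); set A := repr g => A1.
have eigen (v : 'cV[R]_2) : v != 0 -> exists k : R, A *m v = k *: v.
  move=> v0; have [x [c [c0 vx]]] := circle_vec_line v v0.
  have /circle_vec_line[y [k [k0 Ax]]] : A *m circle_vec x != 0.
    apply: contra_neq (circle_vec_neq0 x) => Ax.
    by rewrite -[LHS](mulKmx (SL2_unit A)) Ax mulmx0.
  have : cls x = cls y by rewrite -(PSL2_homeo_cls _ _ _ _ Ax) A1.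
  move=> /(congr1 (fun z => val (line_of_circle z))); rewrite !line_of_circleE.
  move=> xy; have : circle_vec y \in <[circle_vec x]>%VS by rewrite xy memv_line.
  move=> /vlineP[d yx]; exists (k * d).
  by rewrite vx -scalemxAr Ax yx !scalerA; congr (_ *: _); ring.
have basis_entry (p q : R) : (p != 0) || (q != 0) -> exists k,
    A 0 0 * p + A 0 1 * q = k * p /\ A 1 0 * p + A 1 1 * q = k * q.
  move=> pq; pose v : 'cV[R]_2 := \col_i (if i == 0 then p else q).
  have /eigen[k /matrixP Av] : v != 0.
    apply: contraTneq pq => /matrixP v0; have := v0 0 0; have := v0 1 0.
    by rewrite !mxE /= => -> ->; rewrite eqxx.
  exists k; have := Av 0 0; have := Av 1 0.
  by rewrite !mulmx2 !mxE.
(* The two basis vectors kill the off-diagonal entries; their sum makes the diagonal entries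
   equal. *)
have [|k1 [a1 c1]] := basis_entry 1 0; first by rewrite oner_eq0.
have [|k2 [a2 c2]] := basis_entry 0 1; first by rewrite oner_eq0 orbT.
have [|k3 [a3 c3]] := basis_entry 1 1; first by rewrite oner_eq0.
have c0 : A 1 0 = 0 by lra.
have b0 : A 0 1 = 0 by lra.
have ad : A 0 0 = A 1 1 by lra.
have /eqP := SL2_det A; rewrite det_mx2 b0 c0 ad mulr0 subr0 => d2.
apply/PSL2_cls_eqP; rewrite /PSL2_rel.
have : (A 1 1 == 1) || (A 1 1 == -1) by rewrite -sqrf_eq1 expr2 d2.
move=> /orP[/eqP d1|/eqP d1]; apply/orP; [left|right]; apply/eqP/matrixP;
  apply: ord2_ind; apply: ord2_ind; rewrite !mxE /= ?b0 ?c0 ?ad ?d1 //;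
  by rewrite ?mulr0n ?oppr0.
Qed.

Lemma PSL2_homeo_inj : injective (@PSL2_homeo R).
Proof.
move=> g h gh; apply: (mulIg h^-1%g); rewrite mulgV; apply: PSL2_homeo_id.
by rewrite PSL2_homeoM gh -PSL2_homeoM mulgV PSL2_homeo1.
Qed.

(** * Lifting elements of [PSL2] to the line *)

Definition has_lift g := exists a : homeo_tilde R, bar a = PSL2_homeo g.

Lemma has_liftM g h : has_lift g -> has_lift h -> has_lift (g * h)%g.
Proof.
by move=> [a ag] [b bh]; exists (a * b)%g; rewrite bar_mul ag bh PSL2_homeoM.
Qed.

Lemma bar_invE (a : homeo_tilde R) g :
  bar a = PSL2_homeo g -> bar a^-1%g = PSL2_homeo g^-1%g.
Proof.
move=> ag.
have -> : bar a^-1%g = (bar a^-1%g \o PSL2_homeo g) \o PSL2_homeo g^-1%g.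
  by rewrite -compA -PSL2_homeoM mulgV PSL2_homeo1.
by rewrite -ag bar_inv.
Qed.

Lemma has_liftV g : has_lift g -> has_lift g^-1%g.
Proof. by move=> [a ag]; exists a^-1%g; exact: bar_invE. Qed.

(** The angle [pi * t] matches the scaling in [circle_vec], so the circle coordinate moves by
    exactly [t]. *)
Definition rot_mx t : 'M[R]_2 := \matrix_(i, j)
  if i == 0 then (if j == 0 then cos (pi * t) else - sin (pi * t))
  else (if j == 0 then sin (pi * t) else cos (pi * t)).

Fact rot_det t : \det (rot_mx t) == 1.
Proof.
by rewrite det_mx2 !mxE /= mulNr opprK -!expr2 cos2Dsin2.
Qed.

Definition rot t : SL2 R := MkSL2 (rot_det t).

Lemma rot_circle_vec t x : rot t *m circle_vec x = circle_vec (x + t).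
Proof.
apply/matrixP => i j; rewrite (ord1 j) mulmx2 /=; move: i.
by apply: ord2_ind; rewrite !mxE /= mulrDr ?cosD ?sinD; ring.
Qed.

Lemma has_lift_rot t : has_lift (PSL2_cls (rot t)).
Proof.
exists (translation t); apply/funext => x; rewrite -(reprK x) -/(cls _) barE /=.
apply/esym/(PSL2_homeo_cls _ _ _ 1); first by rewrite scale1r rot_circle_vec.
Qed.

(** With [v = circle_vec x], this is the inner product of [M v] and [v]; [vec_cross] below is the
    determinant with columns [v] and [M v]. *)
Definition vec_dot (M : 'M[R]_2) x :=
  (M 0 0 * cos (pi * x) + M 0 1 * sin (pi * x)) * cos (pi * x) +
  (M 1 0 * cos (pi * x) + M 1 1 * sin (pi * x)) * sin (pi * x).

Definition vec_cross (M : 'M[R]_2) x :=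
  (M 1 0 * cos (pi * x) + M 1 1 * sin (pi * x)) * cos (pi * x) -
  (M 0 0 * cos (pi * x) + M 0 1 * sin (pi * x)) * sin (pi * x).

(* atan (cross / dot) is the signed angle, mod pi, from circle_vec x to its image
   under M; the quotient is the junk value 0 when dot vanishes. *)
Definition turn (M : 'M[R]_2) x := x + atan (vec_cross M x / vec_dot M x) / pi.

Lemma turn_circle_vec (M : 'M[R]_2) x : vec_dot M x != 0 ->
  exists k : R, M *m circle_vec x = k *: circle_vec (turn M x).
Proof.
move=> d0; set q := vec_cross M x / vec_dot M x.
have qE : q * vec_dot M x = vec_cross M x by rewrite divfK.
have cq : cos (atan q) != 0.
  by rewrite gt_eqF // cos_gt0_pihalf // atan_gtNpi2 atan_ltpi2.
have sq : sin (atan q) = q * cos (atan q) := canRL (divfK cq) (atanK q).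
have piE : pi * turn M x = pi * x + atan q.
  by rewrite mulrDr [pi * (_ / _)]mulrC divfK // gt_eqF // pi_gt0.
have cs := cos2Dsin2 (pi * x).
(* Let [w] be [v = circle_vec x] after a quarter turn. Then [M v] is [vec_dot] times [v + q w],
   while turning [v] by [atan q] gives [cos (atan q)] times [v + q w]. *)
exists (vec_dot M x / cos (atan q)).
apply/matrixP => i j; rewrite (ord1 j) mulmx2; move: i.
apply: ord2_ind; rewrite !mxE /= piE ?cosD ?sinD sq.
  transitivity (vec_dot M x * cos (pi * x) -
    (q * vec_dot M x) * sin (pi * x)); last by field.
  rewrite qE /vec_dot /vec_cross -[LHS]mulr1 -cs; ring.
transitivity (vec_dot M x * sin (pi * x) +
  (q * vec_dot M x) * cos (pi * x)); last by field.
rewrite qE /vec_dot /vec_cross -[LHS]mulr1 -cs; ring.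
Qed.

Lemma turn_near M x : `|turn M x - x| < 2^-1.
Proof.
rewrite addrAC subrr add0r normrM normfV [`|pi|]gtr0_norm ?pi_gt0 //.
rewrite ltr_pdivrMr ?pi_gt0 // [2^-1 * _]mulrC ltr_norml.
by rewrite atan_gtNpi2 atan_ltpi2.
Qed.

(** Both [vec_dot] and [vec_cross] are quadratic in [circle_vec x], which only changes sign. *)
Lemma turnD1 M x : turn M (x + 1) = turn M x + 1.
Proof.
have -> : turn M (x + 1) = x + 1 + atan (vec_cross M x / vec_dot M x) / pi.
  rewrite /turn /vec_cross /vec_dot mulrDr mulr1 cosDpi sinDpi.
  by congr (_ + atan (_ / _) / _); ring.
by rewrite addrAC.
Qed.

(** A symmetric matrix of determinant 1 is definite, as completing the square shows. *)
Lemma sym_dot_neq0 B x : (B : 'M[R]_2)^T = B -> vec_dot B x != 0.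
Proof.
move=> /matrixP/(_ 0 1); rewrite mxE => sB.
have /eqP := SL2_det B; rewrite det_mx2 => dB.
have cs := cos2Dsin2 (pi * x).
apply/eqP => d0.
have : (B 0 0 * cos (pi * x) + B 0 1 * sin (pi * x)) ^+ 2 + sin (pi * x) ^+ 2
    = B 0 0 * vec_dot B x.
  rewrite -[sin _ ^+ 2 in LHS]mul1r -dB /vec_dot sB; ring.
rewrite d0 mulr0 => /eqP; rewrite paddr_eq0 ?sqr_ge0 // !sqrf_eq0.
move=> /andP[/eqP h /eqP s0]; move: h cs; rewrite s0 mulr0 addr0 => /eqP.
rewrite mulf_eq0 => /orP[/eqP a0|/eqP ->]; last first.
  by rewrite expr0n addr0 => /eqP; rewrite eq_sym oner_eq0.
by move: dB; rewrite a0 sB mul0r; nra.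
Qed.

(** Since [A B = 1], going forth and back returns to the same line, hence to [x] up to an integer;
    each turn moves by less than 1/2, so that integer is 0. *)
Lemma turnK A B : A *m B = 1%:M -> (forall x, vec_dot A x != 0) ->
  (forall x, vec_dot B x != 0) -> cancel (turn B) (turn A).
Proof.
move=> AB A0 B0 x; set y := turn B x.
have [k Bx] := turn_circle_vec B x (B0 x).
have [l Ay] := turn_circle_vec A y (A0 y).
have /circle_vec_collinear/cls_eqP/intrP[n xn] :
    circle_vec x = (k * l) *: circle_vec (turn A y).
  by rewrite -[LHS]mul1mx -AB -mulmxA Bx -scalemxAr Ay scalerA.
have := turn_near B x; have := turn_near A y; rewrite -/y !ltr_norml.
move=> /andP[? ?] /andP[? ?].
have : n%:~R < 1%:~R :> R by rewrite -xn; lra.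
have : (-1)%:~R < n%:~R :> R by rewrite -xn intrN; lra.
rewrite !ltr_int => ? ?; have n0 : n = 0 by lia.
by move: xn; rewrite n0; lra.
Qed.

Lemma turn_continuous M : (forall x, vec_dot M x != 0) -> continuous (turn M).
Proof.
move=> M0 x; rewrite /turn.
have pix : {for x, continuous (fun x : R => pi * x)}.
  by apply: cvgM; [exact: cvg_cst|exact: cvg_id].
have cx : {for x, continuous (fun x : R => cos (pi * x))}.
  exact: (continuous_comp pix (@continuous_cos R _)).
have sx : {for x, continuous (fun x : R => sin (pi * x))}.
  exact: (continuous_comp pix (@continuous_sin R _)).
have lin (p q : R) :
    {for x, continuous (fun x : R => p * cos (pi * x) + q * sin (pi * x))}.
  by apply: cvgD; apply: cvgM => //; exact: cvg_cst.
apply: cvgD; first exact: cvg_id.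
apply: cvgM; last exact: cvg_cst.
apply: (@continuous_comp _ _ _ (fun x => vec_cross M x / vec_dot M x) atan);
  last exact: continuous_atan.
apply: cvgM; first by apply: cvgB; apply: cvgM => //; exact: lin.
by apply: cvgV => //; apply: cvgD; apply: cvgM => //; exact: lin.
Qed.

(** The inverse of [B] is symmetric too, so its own [turn] is the continuous inverse. *)
Lemma has_lift_sym B : (B : 'M[R]_2)^T = B -> has_lift (PSL2_cls B).
Proof.
move=> sB; have B0 x := sym_dot_neq0 B x sB.
have V0 x : vec_dot (B^-1)%g x != 0.
  by apply: sym_dot_neq0; rewrite /= trmx_inv sB.
have turn_homeo : homeomorphism (turn B).
  split; first exact: turn_continuous.
  exists (turn (B^-1)%g); first exact: turn_continuous.
  by split; apply: turnK => //=; rewrite ?mulVmx ?mulmxV ?SL2_unit.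
exists (HomeoTilde turn_homeo (turnD1 B)).
apply/funext => x; rewrite -(reprK x) -/(cls _) barE /=.
have [k Bx] := turn_circle_vec B (repr x) (B0 _).
by rewrite (PSL2_homeo_cls _ _ _ _ Bx).
Qed.

Lemma PSL2_has_lift g : has_lift g.
Proof.
rewrite -(PSL2_clsK g); set A := repr g.
(* Rotating by the direction of this vector makes A symmetric. *)
pose v : 'cV[R]_2 := \col_i (if i == 0 then A 0 0 + A 1 1 else A 0 1 - A 1 0).
have v0 : v != 0.
  (* If [v] vanished, the determinant would be minus a sum of two squares. *)
  apply/eqP => /matrixP v0; have := v0 0 0; have := v0 1 0; rewrite !mxE /=.
  by have /eqP := SL2_det A; rewrite det_mx2; nra.
have [t [k [k0 /matrixP vt]]] := circle_vec_line v v0.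
have := vt 0 0; have := vt 1 0; rewrite !mxE /= => st ct.
have sB : ((rot t * A)%g : 'M[R]_2)^T = (rot t * A)%g.
  (* Symmetry says that [(cos (pi * t), sin (pi * t))] is proportional to [v]; multiplying by [k]
     turns these into the entries of [v]. *)
  have B01 : (rot t *m A) 0 1 = (rot t *m A) 1 0.
    rewrite !mulmx2 !mxE /=; apply: (mulfI k0).
    pose c := k * cos (pi * t); pose s := k * sin (pi * t).
    transitivity (c * A 0 1 - s * A 1 1); first by rewrite /c /s; ring.
    transitivity (s * A 0 0 + c * A 1 0); last by rewrite /c /s; ring.
    by rewrite /c /s -st -ct; ring.
  apply/matrixP; apply: ord2_ind; apply: ord2_ind; rewrite [LHS]mxE //=.
have -> : PSL2_cls A = ((PSL2_cls (rot t))^-1 * PSL2_cls (rot t * A))%g.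
  by rewrite -[PSL2_cls (_ * _)%g]PSL2_mulE mulKg.
by apply: has_liftM; [exact/has_liftV/has_lift_rot|exact: has_lift_sym].
Qed.

Lemma bar_canonical_lift g : bar (canonical_lift (PSL2_homeo g)) = PSL2_homeo g.
Proof.
have [a ag] := PSL2_has_lift g.
pose P := [set a | bar a = PSL2_homeo g /\ 0 <= a 0 < 1]%classic.
apply: (proj1 (xgetPex 1%g (P := P) _)).
(* Inhabiting the set rules out the default of [xget]; shifting any lift by this floor brings its
   value at 0 into [[0, 1)]. *)
exists (translation (- Num.floor (a 0))%:~R * a)%g; split.
  by rewrite bar_mul bar_translation ag.
rewrite /= intrN subr_ge0 floor_le /= ltrBlDr addrC.
by rewrite -[1]/(1%:~R) -intrD floorD1_gt.
Qed.

End ProjectiveAction.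

(** * Conjugacy classes as sets *)

Section ConjugacyClasses.
Variable G : groupType.
Implicit Types x y h : G.

Lemma conj_class_eq (C D : conj_class G) x y h :
  sval C x -> sval D y -> y = (x ^ h)%g -> C = D.
Proof.
case: C D => [C pC] [D pD] /= Cx Dy yE; apply: eq_exist.
case: pC Cx => c ->; case: pD Dy => d -> [g _ yg] [f _ xf].
have [w cd] : exists w, d = (c ^ w)%g.
  by exists (f * h * g^-1)%g; rewrite !conjgM -xf -yE yg conjgK.
apply/funext => z; apply/propext; split=> -[u _ ->].
  by exists (w^-1 * u)%g => //; rewrite cd conjgM conjgK.
by exists (w * u)%g => //; rewrite conjgM -cd.
Qed.

Lemma conj_class_of x : is_conj_class [set y | conjugate_in setT x y]%classic.
Proof. by exists x. Qed.

End ConjugacyClasses.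

Theorem proposition4p1 (R : realType)
    (phi : conj_class (PSL2 R) -> PSL2 R)
    (phi_repr : forall i : conj_class (PSL2 R), sval i (phi i))
    (alpha : homeo_tilde R) (alpha_SL2 : SL2_tilde alpha) :
  exists! ik : conj_class (PSL2 R) * int,
    conjugate_in (@SL2_tilde R)
      (translation (ik.2%:~R : R) *
         canonical_lift (PSL2_homeo (phi ik.1)))%g
      alpha.
Proof.
have [g _ ga] := alpha_SL2.
pose i : conj_class (PSL2 R) := exist _ _ (conj_class_of _ g).
have [h _ gh] : conjugate_in setT g (phi i) := phi_repr i.
have [a ah] := PSL2_has_lift R h.
have /bar_inj[k alphaE] :
    bar alpha = bar (canonical_lift (PSL2_homeo (phi i)) ^ a^-1)%g.
  rewrite conjgE invgK !bar_mul bar_canonical_lift ah (bar_invE _ _ _ ah).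
  by rewrite -!PSL2_homeoM -ga -[in LHS](conjgK h g) -gh conjgE invgK.
have alpha_conj : alpha =
    ((translation k%:~R * canonical_lift (PSL2_homeo (phi i))) ^ a^-1)%g.
  by rewrite alphaE conjMg translation_conj.
exists (i, k); split.
  by exists a^-1%g => //=; exists h^-1%g => //; rewrite (bar_invE _ _ _ ah).
move=> [j l] /= [b [f _ fb] alphaE'].
(* Projecting the second conjugacy to the circle, faithfulness makes [g] conjugate to [phi j] in
   [PSL2]. *)
have ij : i = j.
  apply: esym; apply: (@conj_class_eq _ j i (phi j) g f) => //.
    by exists 1%g => //; rewrite conjg1.
  apply: PSL2_homeo_inj; rewrite ga alphaE' conjgE conjgE !bar_mul bar_translation.
  by rewrite bar_canonical_lift (bar_invE _ _ _ (esym fb)) -fb -!PSL2_homeoM.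
congr (_, _) => //; rewrite -ij in alphaE'.
set c := canonical_lift _ in alpha_conj alphaE'.
(* Equating the two expressions of [alpha] and moving the central translations to one side makes [c]
   conjugate to its own shift by [l - k]. *)
have cE : (c ^ (a^-1 * b^-1))%g = (translation (l - k)%:~R * c)%g.
  have : (alpha ^ b^-1)%g = (translation l%:~R * c)%g by rewrite alphaE' conjgK.
  rewrite alpha_conj -conjgM conjMg translation_conj => cE.
  by rewrite addrC translationD -mulgA -cE mulgA -translationD addNr mul1g.
by apply/esym/eqP; rewrite -subr_eq0; apply/eqP; exact: conjg_translation_eq0 cE.
Qed.
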